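(* (i) Let $P_3$ be a complex polynomial of degree $3$ with all coefficients nonzero, and suppose that $|q_k(P_3)| > \sqrt{9+6\sqrt{3}}$ for $k = 2, 3$. Then all the zeros of $P_3$ are simple. Moreover, the moduli of all zeros of $P_3$ are pairwise different. (Here $4 = b_2 < \sqrt{9+6\sqrt{3}} < b_4$.) (ii) There exists a complex polynomial $Q_3$ of degree $3$ with all coefficients nonzero such that $|q_k(Q_3)| = \sqrt{9+6\sqrt{3}}$ for $k = 2, 3$, and $Q_3$ has a multiple root.
   Context: For a polynomial $P(z)=\sum_{k=0}^{3} a_k z^k$ with all coefficients $a_0,a_1,a_2,a_3 \in \mathbb{C}\setminus\{0\}$, the second quotients of its coefficients are $q_2(P) = \dfrac{a_1^2}{a_0a_2}$ and $q_3(P)=\dfrac{a_2^2}{a_1a_3}$. For $n \in \{1,2\}$, $b_{2n}$ denotes the unique positive root $x$ of the equation $1 - 2\sum_{k=1}^{n} x^{-k^2/2} = 0$. Numerically, $\sqrt{9+6\sqrt{3}} \approx 4.4036695$ and $b_4 \approx 4.79753651$. *)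

(* Defs.v *)
From mathcomp Require Import all_boot all_order all_algebra.
From mathcomp Require Import complex.
From mathcomp Require Import reals exp.

Set Implicit Arguments.
Unset Strict Implicit.
Unset Printing Implicit Defensive.

Import Order.TTheory GRing.Theory Num.Theory.

Local Open Scope ring_scope.
Local Open Scope complex_scope.

(* The degree is [(size P).-1]. *)
Definition full_poly_of_degree (R : realType) (n : nat) (P : {poly R[i]}) : Prop :=
  size P = n.+1 /\ forall k : nat, (k <= n)%N -> P`_k != 0.

(* Meaningful for [2 <= k]. *)
Definition second_quotient (R : realType) (k : nat) (P : {poly R[i]}) : R[i] :=
  P`_(k - 1) ^+ 2 / (P`_(k - 2) * P`_k).

Definition threshold (R : realType) : R := Num.sqrt (9 + 6 * Num.sqrt 3).

Definition simple_zero (R : realType) (P : {poly R[i]}) (z : R[i]) : Prop :=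
  mup z P = 1%N.

Definition multiple_zero (R : realType) (P : {poly R[i]}) (z : R[i]) : Prop :=
  (2 <= mup z P)%N.

Definition b_equation (R : realType) (n : nat) (x : R) : Prop :=
  1 - 2 * \sum_(1 <= k < n.+1) x `^ (- (k%:R ^+ 2 / 2)) = 0.

(* [x] is the number b_(2n). *)
Definition is_b (R : realType) (n : nat) (x : R) : Prop :=
  unique (fun y : R => 0 < y /\ b_equation n y) x.

(* Main.v *)
(* If two of the three roots share the squared modulus [N], let [W] be the squared modulus of
   the third root w, [m] that of the sum u + v of the two, and [s = 2 Re (w * conj (u + v))].
   Then the elementary symmetric functions satisfy |e1|^2 = W + m + s and
   |e2|^2 = N^2 + W m + N s, so everything reduces to a real inequality. One may assume [N = 1]
   by scaling and [W >= 1] by inverting the roots. With r^2 = W, q^2 = m, A = |e2|^2, B = |e1|^2,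
   one has A = B + D, D = (q^2 - 1)(r^2 - 1), and |q_2| > T means that the parabola
   (x + D)^2 - T^2 r^2 x is positive at x = B. It is nonpositive at x = (r + q)^2, the largest
   possible B. It is also nonpositive at a lower bound of B: at (r - q)^2, the smallest possible
   B, if r is at least the extremal value r0, and at T^2 r^(2/3), a lower bound of B that
   follows from both quotient conditions, if r <= r0. Hence it is nonpositive at B. The extremal
   case is (z - 1)^2 (z + r0). *)

Require Import Defs.
From mathcomp Require Import all_boot all_order all_algebra.
From mathcomp Require Import ring lra.
From mathcomp Require Import complex.
From mathcomp Require Import reals exp.

Set Implicit Arguments.
Unset Strict Implicit.
Unset Printing Implicit Defensive.

Import Order.TTheory GRing.Theory Num.Theory.

Local Open Scope ring_scope.
Local Open Scope complex_scope.

(** A parabola opening upwards lies below its chord. *)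
Lemma quadratic_le0 (F : realFieldType) (a b c x y z : F) : 0 <= a -> x <= z <= y ->
  a * x ^+ 2 + b * x + c <= 0 -> a * y ^+ 2 + b * y + c <= 0 ->
  a * z ^+ 2 + b * z + c <= 0.
Proof.
move=> a0 /andP[xz zy] fx fy.
have [xy|yx] := ltP x y; last by have -> : z = x by lra.
have yx_gt0 : 0 < y - x by lra.
rewrite -(pmulr_rle0 _ yx_gt0).
have -> : (y - x) * (a * z ^+ 2 + b * z + c) =
  (y - z) * (a * x ^+ 2 + b * x + c) + (z - x) * (a * y ^+ 2 + b * y + c)
  - a * ((y - z) * (z - x) * (y - x)) by ring.
have : (y - z) * (a * x ^+ 2 + b * x + c) <= 0 by rewrite mulr_ge0_le0 //; lra.
have : (z - x) * (a * y ^+ 2 + b * y + c) <= 0 by rewrite mulr_ge0_le0 //; lra.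
have : 0 <= a * ((y - z) * (z - x) * (y - x)) by rewrite !mulr_ge0 //; lra.
lra.
Qed.

(** * The threshold and the extremal root *)

Section RealInequalities.
Variable R : realType.
Implicit Types q r : R.

Let s3 : R := Num.sqrt 3.
Let t3 : R := Num.sqrt (2 * s3).
Let T : R := threshold R.

Lemma sqr_sqrt3 : s3 ^+ 2 = 3. Proof. by rewrite sqr_sqrtr. Qed.

Lemma sqrt3_bounds : 17 / 10 < s3 < 18 / 10.
Proof.
have s_ge0 : 0 <= s3 by exact: sqrtr_ge0.
have := sqr_sqrt3; nra.
Qed.

Lemma sqr_sqrt_sqrt12 : t3 ^+ 2 = 2 * s3.
Proof. by rewrite sqr_sqrtr //; have := sqrt3_bounds; lra. Qed.

Lemma sqrt_sqrt12_bounds : 18 / 10 < t3 < 19 / 10.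
Proof.
have t_ge0 : 0 <= t3 by exact: sqrtr_ge0.
have := sqr_sqrt_sqrt12; have := sqrt3_bounds; nra.
Qed.

Lemma sqr_threshold : T ^+ 2 = 9 + 6 * s3.
Proof. by rewrite sqr_sqrtr //; have := sqrt3_bounds; rewrite -/s3; lra. Qed.

Lemma threshold_bounds : 4 < T < 45 / 10.
Proof.
have T_ge0 : 0 <= T by exact: sqrtr_ge0.
have := sqr_threshold; have := sqrt3_bounds; nra.
Qed.

(** With [T] polynomial in [s3] and [t3], identities involving it follow by [field] modulo the
    equations for the squares of [s3] and [t3]. *)
Lemma thresholdE : T = t3 * (3 + s3) / 2.
Proof.
have := sqr_threshold; have := threshold_bounds.
have := sqrt_sqrt12_bounds; have := sqr_sqrt_sqrt12; have := sqr_sqrt3; have := sqrt3_bounds.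
move=> sb s2 t2 tb Tb T2.
apply/eqP; rewrite -(eqrXn2 (n := 2)) //; [| lra | nra].
apply/eqP; rewrite T2.
have -> : (t3 * (3 + s3) / 2) ^+ 2 = t3 ^+ 2 * (9 + 6 * s3 + s3 ^+ 2) / 4 by field.
rewrite t2 s2.
have -> : 2 * s3 * (9 + 6 * s3 + 3) / 4 = 6 * s3 + 3 * s3 ^+ 2 by field.
by rewrite s2; lra.
Qed.

(* The larger root of [r + 1 / r = 7 + 3 sqrt 3], which is [c ^ 3] for the larger root [c] of
   [c + 1 / c = 1 + sqrt 3]. *)
Definition extremal_root : R := (7 + 3 * s3 + (3 + 2 * s3) * t3) / 2.
Let r0 := extremal_root.

Lemma extremal_root_gt2 : 2 < r0.
Proof. rewrite /r0 /extremal_root; have := sqrt3_bounds; have := sqrt_sqrt12_bounds; nra. Qed.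

(** The cubic (z - 1)^2 (z + r0) has coefficients r0, -(2 r0 - 1), r0 - 2, 1, so this is |q_2| = T,
    and [extremal_q3] is |q_3| = T. *)
Lemma extremal_q2 : (2 * r0 - 1) ^+ 2 = T * (r0 * (r0 - 2)).
Proof.
rewrite thresholdE /r0 /extremal_root.
have := sqr_sqrt_sqrt12; have := sqr_sqrt3.
move: s3 t3 => s t s2 t2.
by field: s2 t2.
Qed.

Lemma extremal_q3 : (r0 - 2) ^+ 2 = T * (2 * r0 - 1).
Proof.
rewrite thresholdE /r0 /extremal_root.
have := sqr_sqrt_sqrt12; have := sqr_sqrt3.
move: s3 t3 => s t s2 t2.
by field: s2 t2.
Qed.


(** The difference of the two sides vanishes at [r0] by [extremal_q2]; dividing it by [r - r0]
    leaves a linear factor that is nonnegative beyond [r0]. *)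
Lemma extremal_quadratic_le0 r : r0 <= r -> (2 * r - 1) ^+ 2 <= T * (r * (r - 2)).
Proof.
move=> r0r; have r0_gt2 := extremal_root_gt2; have eq0 := extremal_q2.
have := threshold_bounds; rewrite -/T => Tb; rewrite -/r0 in r0_gt2.
have coef : 0 <= (T - 4) * r0 - (2 * T - 4).
  (* By [extremal_q2] this product equals 1. *)
  suff : 0 <= ((T - 4) * r0 - (2 * T - 4)) * r0 by rewrite pmulr_lge0 //; lra.
  have -> : ((T - 4) * r0 - (2 * T - 4)) * r0 = T * (r0 * (r0 - 2)) - 4 * r0 ^+ 2 + 4 * r0 by ring.
  by rewrite -eq0; lra.
suff : 0 <= (r - r0) * ((T - 4) * (r + r0) - (2 * T - 4)) by move: eq0; lra.
apply: mulr_ge0; first lra.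
have : 0 <= (T - 4) * r by apply: mulr_ge0; lra.
lra.
Qed.

(** The hypotheses put [q] beyond the larger root [p] of q^2 - (1 + sqrt 3) q + 1, the smaller root
    being below 1; and p^3 = r0. *)
Lemma extremal_root_le q : 1 <= q -> (1 + s3) * q < q ^+ 2 + 1 -> r0 <= q ^+ 3.
Proof.
move=> q1 hq; have sb := sqrt3_bounds; have tb := sqrt_sqrt12_bounds.
have s2 := sqr_sqrt3; have t2 := sqr_sqrt_sqrt12.
pose p := (1 + s3 + t3) / 2.
have -> : r0 = p ^+ 3.
  by rewrite /r0 /extremal_root /p; move: (s3) (t3) s2 t2 => s t s2 t2; field: s2 t2.
have p_ge0 : 0 <= p by rewrite /p; lra.
apply: lerXn2r; rewrite ?nnegrE //; first lra.
have [//|qp] := leP p q.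
have : 0 < (q - p) * (q - (1 + s3 - t3) / 2).
  have -> : (q - p) * (q - (1 + s3 - t3) / 2) =
      q ^+ 2 - (1 + s3) * q + (1 + 2 * s3 + s3 ^+ 2 - t3 ^+ 2) / 4.
    by rewrite /p; field.
  by rewrite s2 t2; lra.
rewrite nmulr_rgt0; last by lra.
lra.
Qed.

(** * Incompatibility of the two quotient conditions for two roots of equal modulus *)

Lemma threshold_quotients_core (c r q s A B : R) : 1 <= c -> r = c ^+ 3 -> 0 <= q <= 2 ->
  `|s| <= 2 * (r * q) -> A = 1 + r ^+ 2 * q ^+ 2 + s -> B = r ^+ 2 + q ^+ 2 + s ->
  T ^+ 2 * (r ^+ 2 * B) < A ^+ 2 -> T ^+ 2 * A < B ^+ 2 -> False.
Proof.
move=> c1 rE /andP[q0 q2] /[!ler_norml] /andP[s_ge s_le] AE BE hA hB.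
have := threshold_bounds; rewrite -/T => Tb.
have r1 : 1 <= r by rewrite rE exprn_ege1.
have rq0 : 0 <= r * q by apply: mulr_ge0; lra.
have rqM : r * q <= r * 2 by rewrite ler_wpM2l //; lra.
have T2_16 : 16 <= T ^+ 2 by nra.
have A_le : A <= (1 + r * q) ^+ 2 by rewrite AE; lra.
have A_ge : (r * q - 1) ^+ 2 <= A by rewrite AE; lra.
have B_le : B <= (r + q) ^+ 2 by rewrite BE; lra.
have B_ge : (r - q) ^+ 2 <= B by rewrite BE; lra.
have A_ge0 : 0 <= A by apply: le_trans A_ge; exact: sqr_ge0.
have B_ge0 : 0 <= B by apply: le_trans B_ge; exact: sqr_ge0.
pose D := (q ^+ 2 - 1) * (r ^+ 2 - 1).
have AD : A = B + D by rewrite AE BE /D; ring.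
have r2 : 1 <= r ^+ 2 by rewrite exprn_ege1.
(* If q <= 1, then D <= 0, so A <= B, while A <= 4 r^2; hence A^2 <= 4 r^2 B, against the first
   condition. *)
have [q_le1|q_gt1] := leP q 1.
  have D_le0 : D <= 0 by apply: mulr_le0_ge0; [nra | lra].
  have rqr : r * q <= r by rewrite ler_piMr //; lra.
  have A_le4 : A <= 4 * r ^+ 2 by apply: le_trans A_le _; nra.
  have : T ^+ 2 * (r ^+ 2 * B) >= 4 * r ^+ 2 * A.
    have : 0 <= r ^+ 2 * B by apply: mulr_ge0; lra.
    have : r ^+ 2 * A <= r ^+ 2 * B by apply: ler_wpM2l; lra.
    by nra.
  have : A * A <= 4 * r ^+ 2 * A by apply: ler_wpM2r; lra.
  lra.
have D_ge0 : 0 <= D by apply: mulr_ge0; [nra | lra].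
have B_gt0 : 0 < B.
  rewrite lt_neqAle B_ge0 andbT; apply/eqP => B0.
  by move: hB; rewrite -B0 expr0n /=; nra.
have A_gt0 : 0 < A by lra.
(* [B] lies in an interval at whose ends [x |-> (x + D)^2 - T^2 r^2 x] is nonpositive. *)
suff key x : x <= B -> (x + D) ^+ 2 <= T ^+ 2 * (r ^+ 2 * x) -> False.
  (* Since r = c^3, the first case is r <= r0: [c] is at most the larger root of c + 1 / c = 1 +
     sqrt 3. *)
  have [sub|sup] := leP (c ^+ 2 + 1) ((1 + s3) * c).
    apply: (key (T ^+ 2 * c ^+ 2)).
      (* Squaring T^2 A < B^2 and inserting the bound for A^2 gives T^6 r^2 B < B^4, so B^3 > (T^2
         c^2)^3. *)
      have [//|B_lt] := leP (T ^+ 2 * c ^+ 2) B.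
      have T2A_ge0 : 0 <= T ^+ 2 * A by apply: mulr_ge0; lra.
      have : (T ^+ 2 * A) ^+ 2 < (B ^+ 2) ^+ 2 by rewrite ltr_pXn2r ?nnegrE ?sqr_ge0.
      have : T ^+ 4 * (T ^+ 2 * (r ^+ 2 * B)) < T ^+ 4 * A ^+ 2.
        by rewrite ltr_pM2l //; apply: exprn_gt0; lra.
      have : B ^+ 3 <= (T ^+ 2 * c ^+ 2) ^+ 3.
        by apply: lerXn2r (ltW B_lt); rewrite nnegrE //; lra.
      rewrite -(ler_pM2r B_gt0) rE => h1 h2 h3.
      suff : B ^+ 3 * B < B ^+ 3 * B by rewrite ltxx.
      apply: le_lt_trans h1 _.
      have -> : (T ^+ 2 * c ^+ 2) ^+ 3 * B = T ^+ 4 * (T ^+ 2 * ((c ^+ 3) ^+ 2 * B)) by ring.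
      apply: lt_trans h2 _; have -> : T ^+ 4 * A ^+ 2 = (T ^+ 2 * A) ^+ 2 by ring.
      by have -> : B ^+ 3 * B = (B ^+ 2) ^+ 2 by ring.
    (* Both sides are now squares, and the claim is T^2 c^2 + D <= T^2 c^4. *)
    have -> : T ^+ 2 * (r ^+ 2 * (T ^+ 2 * c ^+ 2)) = (T ^+ 2 * c ^+ 4) ^+ 2.
      by rewrite rE; ring.
    have c2 : 1 <= c ^+ 2 by rewrite exprn_ege1.
    apply: lerXn2r; rewrite ?nnegrE.
    - by apply: addr_ge0 => //; apply: mulr_ge0; lra.
    - by apply: mulr_ge0; [lra | apply: exprn_ge0; lra].
    have D_le : D <= 3 * (r ^+ 2 - 1).
      by rewrite /D ler_wpM2r //; [lra | nra].
    suff : 3 * (r ^+ 2 - 1) <= T ^+ 2 * c ^+ 2 * (c ^+ 2 - 1) by lra.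
    have -> : 3 * (r ^+ 2 - 1) = 3 * (c ^+ 4 + c ^+ 2 + 1) * (c ^+ 2 - 1) by rewrite rE; ring.
    apply: ler_wpM2r; first lra.
    (* As c^4 + c^2 + 1 = (c^2 + 1)^2 - c^2, the case hypothesis bounds it by (3 + 2 sqrt 3) c^2,
       and 3 (3 + 2 sqrt 3) is exactly T^2. *)
    have : (c ^+ 2 + 1) ^+ 2 <= ((1 + s3) * c) ^+ 2.
      by apply: lerXn2r sub; rewrite nnegrE; have := sqrt3_bounds; nra.
    have -> : ((1 + s3) * c) ^+ 2 = (1 + 2 * s3 + s3 ^+ 2) * c ^+ 2 by ring.
    by rewrite /T sqr_threshold sqr_sqrt3; lra.
  apply: (key ((r - q) ^+ 2)) => //.
  have rr0 : r0 <= r by rewrite rE; exact: extremal_root_le.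
  have r0_gt2 := extremal_root_gt2.
  rewrite -/r0 in r0_gt2.
  have h2 := extremal_quadratic_le0 rr0.
  have -> : (r - q) ^+ 2 + D = (r * q - 1) ^+ 2 by rewrite /D; ring.
  have -> : T ^+ 2 * (r ^+ 2 * (r - q) ^+ 2) = (T * (r * (r - q))) ^+ 2 by ring.
  apply: lerXn2r; rewrite ?nnegrE ?sqr_ge0 //.
    by rewrite !mulr_ge0 //; lra.
  (* Convex in [q], so it is checked at 0 and at 2, where it is [extremal_quadratic_le0]. *)
  suff : (r ^+ 2) * q ^+ 2 + (T * r - 2 * r) * q + (1 - T * r ^+ 2) <= 0 by lra.
  by apply: (quadratic_le0 (x := 0) (y := 2)); [lra | lra | nra | lra].
move=> xB hx.
suff : (B + D) ^+ 2 <= T ^+ 2 * (r ^+ 2 * B) by rewrite -AD; lra.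
suff : 1 * B ^+ 2 + (2 * D - T ^+ 2 * r ^+ 2) * B + D ^+ 2 <= 0 by lra.
apply: (quadratic_le0 (x := x) (y := (r + q) ^+ 2)); [lra | by rewrite xB | lra |].
suff : ((r + q) ^+ 2 + D) ^+ 2 <= T ^+ 2 * (r ^+ 2 * (r + q) ^+ 2) by lra.
have -> : (r + q) ^+ 2 + D = (r * q + 1) ^+ 2 by rewrite /D; ring.
have -> : T ^+ 2 * (r ^+ 2 * (r + q) ^+ 2) = (T * (r * (r + q))) ^+ 2 by ring.
apply: lerXn2r; rewrite ?nnegrE ?sqr_ge0 //.
  by rewrite !mulr_ge0 //; lra.
(* At this end the bound already holds with 4 in place of [T]. *)
have : 4 * (r * (r + q)) <= T * (r * (r + q)).
  by rewrite ler_wpM2r ?mulr_ge0 //; lra.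
have : 0 <= (r * 2 - r * q) * (2 * r + r * q - 1).
  by apply: mulr_ge0; lra.
nra.
Qed.

End RealInequalities.

(** Substitute r = sqrt W, q = sqrt m and c = W^(1/6); the hypothesis on s^2 is the Cauchy-Schwarz
    bound. *)
Lemma threshold_quotients_ge1 (R : realType) (W m s : R) : 1 <= W -> 0 <= m <= 4 ->
  s ^+ 2 <= 4 * W * m ->
  threshold R ^+ 2 * (W * (W + m + s)) < (1 + W * m + s) ^+ 2 ->
  threshold R ^+ 2 * (1 + W * m + s) < (W + m + s) ^+ 2 -> False.
Proof.
move=> W1 /andP[m0 m4] hs.
have W0 : 0 <= W by lra.
have r1 : 1 <= Num.sqrt W by rewrite -sqrtr1 ler_wsqrtr.
pose c := Num.sqrt W `^ 3^-1.
have rE : Num.sqrt W = c ^+ 3.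
  by rewrite /c -powR_mulrn ?powR_ge0 // -powRrM mulVf ?pnatr_eq0 // powRr1 // sqrtr_ge0.
have c1 : 1 <= c.
  have [//|c_lt1] := leP 1 c.
  have : c ^+ 3 < 1 by rewrite exprn_ilt1 ?powR_ge0.
  by rewrite -rE; lra.
have q02 : 0 <= Num.sqrt m <= 2.
  rewrite sqrtr_ge0 /=; have -> : (2 : R) = Num.sqrt (2 ^+ 2) by rewrite sqrtr_sqr ger0_norm.
  by rewrite ler_wsqrtr //; lra.
have s_le : `|s| <= 2 * (Num.sqrt W * Num.sqrt m).
  rewrite -sqrtrM // -(ler_pXn2r (n := 2)) ?nnegrE ?mulr_ge0 ?sqrtr_ge0 //.
  rewrite real_normK ?num_real // exprMn sqr_sqrtr ?mulr_ge0 //; lra.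
have := @threshold_quotients_core R c (Num.sqrt W) (Num.sqrt m) s _ _ c1 rE q02 s_le erefl erefl.
by rewrite !(sqr_sqrtr W0) !(sqr_sqrtr m0).
Qed.

(* Inverting the three roots exchanges the two quotients and replaces [W] by [W^-1]. *)
Lemma threshold_quotients_unit (R : realType) (W m s : R) : 0 < W -> 0 <= m <= 4 ->
  s ^+ 2 <= 4 * W * m ->
  threshold R ^+ 2 * (W * (W + m + s)) < (1 + W * m + s) ^+ 2 ->
  threshold R ^+ 2 * (1 + W * m + s) < (W + m + s) ^+ 2 -> False.
Proof.
move=> W0 hm hs hA hB.
have [W1|W1] := leP 1 W; first exact: (threshold_quotients_ge1 W1 hm hs hA hB).
have Wn0 : W != 0 by rewrite gt_eqF.
apply: (@threshold_quotients_ge1 R W^-1 m (s / W)) => //.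
- by rewrite invf_ge1 // ltW.
- have -> : 4 * W^-1 * m = 4 * W * m / W ^+ 2 by field.
  by rewrite expr_div_n ler_wpM2r // invr_ge0 sqr_ge0.
- have -> : threshold R ^+ 2 * (W^-1 * (W^-1 + m + s / W)) =
    threshold R ^+ 2 * (1 + W * m + s) / W ^+ 2 by field.
  have -> : (1 + W^-1 * m + s / W) ^+ 2 = (W + m + s) ^+ 2 / W ^+ 2 by field.
  by rewrite ltr_pM2r // invr_gt0 exprn_gt0.
- have -> : threshold R ^+ 2 * (1 + W^-1 * m + s / W) =
    threshold R ^+ 2 * (W * (W + m + s)) / W ^+ 2 by field.
  have -> : (W^-1 + m + s / W) ^+ 2 = (1 + W * m + s) ^+ 2 / W ^+ 2 by field.
  by rewrite ltr_pM2r // invr_gt0 exprn_gt0.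
Qed.

(** Dividing the roots by sqrt N divides [W], [m] and [s] by [N]; the two conditions are homogeneous
    of degrees 4 and 2. *)
Lemma threshold_quotients (R : realType) (N W m s : R) : 0 < N -> 0 < W -> 0 <= m <= 4 * N ->
  s ^+ 2 <= 4 * W * m ->
  threshold R ^+ 2 * (N ^+ 2 * W * (W + m + s)) < (N ^+ 2 + W * m + N * s) ^+ 2 ->
  threshold R ^+ 2 * (N ^+ 2 + W * m + N * s) < (W + m + s) ^+ 2 -> False.
Proof.
move=> N0 W0 /andP[m0 m4] hs hA hB.
have Nn0 : N != 0 by rewrite gt_eqF.
apply: (@threshold_quotients_unit R (W / N) (m / N) (s / N)).
- by rewrite divr_gt0.
- by rewrite divr_ge0 ?(ltW N0) //= ler_pdivrMr.
- have -> : 4 * (W / N) * (m / N) = 4 * W * m / N ^+ 2 by field.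
  by rewrite expr_div_n ler_wpM2r // invr_ge0 sqr_ge0.
- have -> : threshold R ^+ 2 * (W / N * (W / N + m / N + s / N)) =
    threshold R ^+ 2 * (N ^+ 2 * W * (W + m + s)) / N ^+ 4 by field.
  have -> : (1 + W / N * (m / N) + s / N) ^+ 2 = (N ^+ 2 + W * m + N * s) ^+ 2 / N ^+ 4 by field.
  by rewrite ltr_pM2r // invr_gt0 exprn_gt0.
- have -> : threshold R ^+ 2 * (1 + W / N * (m / N) + s / N) =
    threshold R ^+ 2 * (N ^+ 2 + W * m + N * s) / N ^+ 2 by field.
  have -> : (W / N + m / N + s / N) ^+ 2 = (W + m + s) ^+ 2 / N ^+ 2 by field.
  by rewrite ltr_pM2r // invr_gt0 exprn_gt0.
Qed.

(** * Zeros of complex cubics, and the extremal cubic *)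

Section ComplexRoots.
Variable R : realType.
Implicit Types (u v w z : R[i]) (P : {poly R[i]}).

(** The squared modulus with values in [R], whereas the norm of [R[i]] lands in [R[i]]. *)
Let sqn z : R := complex.Re z ^+ 2 + complex.Im z ^+ 2.

Lemma sqnE z : (sqn z)%:C = `|z| ^+ 2.
Proof. exact: add_Re2_Im2. Qed.

Lemma sqnM z w : sqn (z * w) = sqn z * sqn w.
Proof. by apply: complexI; rewrite rmorphM /= !sqnE normrM exprMn. Qed.

Lemma sqn_gt0 z : (0 < sqn z) = (z != 0).
Proof. by rewrite -ltcR sqnE lt_def exprn_ge0 // andbT expf_eq0 normr_eq0. Qed.

Lemma lt_normc_div (x : R) z w : 0 <= x -> w != 0 ->
  x%:C < `|z / w| -> x ^+ 2 * sqn w < sqn z.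
Proof.
move=> x0 w0; rewrite normrM normfV ltr_pdivlMr ?normr_gt0 // => h.
rewrite -ltcR rmorphM rmorphXn /= !sqnE -exprMn ltr_pXn2r ?nnegrE ?mulr_ge0 //.
by rewrite lecR.
Qed.

Lemma three_roots_moduli u v w :
  u * v * w != 0 -> u * v + u * w + v * w != 0 -> u + v + w != 0 ->
  (threshold R)%:C < `|(u * v + u * w + v * w) ^+ 2 / (u * v * w * (u + v + w))| ->
  (threshold R)%:C < `|(u + v + w) ^+ 2 / (u * v + u * w + v * w)| ->
  `|u| != `|v|.
Proof.
move=> e3 e2 e1 /lt_normc_div h2 /lt_normc_div h3; apply/eqP => uv.
have T0 : 0 <= threshold R by exact: sqrtr_ge0.
have Nuv : sqn u = sqn v by apply: complexI; rewrite !sqnE uv.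
move: e3; rewrite !mulf_eq0 !negb_or -!sqn_gt0 => /andP[/andP[u0 v0] w0].
have {}h3 := h3 T0 e2.
have {}h2 : threshold R ^+ 2 * sqn (u * v * w * (u + v + w)) < sqn ((u * v + u * w + v * w) ^+ 2).
  by apply: h2; rewrite ?mulf_neq0 // -sqn_gt0.
pose m := sqn (u + v).
pose s := 2 * (complex.Re w * complex.Re (u + v) + complex.Im w * complex.Im (u + v)).
have e1E : sqn (u + v + w) = sqn w + m + s.
  by rewrite /m /s /sqn; case: (u) (v) (w) => [a b] [c d] [e f] /=; ring.
have e2E : sqn (u * v + u * w + v * w) = sqn u ^+ 2 + sqn w * m + sqn u * s.
  (* Expand |u v + w (u + v)|^2, using u v conj(u) = |u|^2 v in the cross term. *)
  have -> : sqn (u * v + u * w + v * w) = sqn u * sqn v + sqn w * m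
      + 2 * (sqn u * (complex.Re w * complex.Re v + complex.Im w * complex.Im v)
             + sqn v * (complex.Re w * complex.Re u + complex.Im w * complex.Im u)).
    by rewrite /m /sqn; case: (u) (v) (w) => [a b] [c d] [e f] /=; ring.
  by rewrite -Nuv /s !raddfD /=; ring.
move: h2 h3; rewrite !expr2 !sqnM -!expr2 -Nuv e1E e2E -expr2 => h2 h3.
apply: (@threshold_quotients R (sqn u) (sqn w) m s) => //.
(* The parallelogram law gives m <= 4 N. *)
- have <- : sqn (u + v) + sqn (u - v) = 4 * sqn u.
    transitivity (2 * sqn u + 2 * sqn v); last by rewrite -Nuv; ring.
    by rewrite /sqn; case: (u) (v) => [a b] [c d] /=; ring.
  by rewrite /m /sqn lerDl !addr_ge0 ?sqr_ge0.
(* Lagrange's identity for 4 W m - s^2. *)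
- suff : 0 <= 4 * (complex.Re w * complex.Im (u + v) -
                     complex.Im w * complex.Re (u + v)) ^+ 2 by rewrite /m /s /sqn; lra.
  by rewrite mulr_ge0 // sqr_ge0.
Qed.

(** Divisibility covers two cases at once: a pair of distinct zeros, and a double zero when
    [u = v]. *)
Lemma cubic_factor_moduli P u v : full_poly_of_degree 3 P ->
  (forall k : nat, (2 <= k <= 3)%N -> (threshold R)%:C < `|second_quotient k P|) ->
  ('X - u%:P) * ('X - v%:P) %| P -> `|u| != `|v|.
Proof.
move=> [sizeP coefP] hq /dvdpP[q PE].
have P0 : P != 0 by rewrite -size_poly_eq0 sizeP.
have mon : ('X - u%:P) * ('X - v%:P) \is monic by rewrite monicMl monicXsubC.
have q0 : q != 0 by apply: contraNneq P0; rewrite PE => ->; rewrite mul0r.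
have size_q : size q = 2%N.
  move: sizeP; rewrite PE size_Mmonic // size_mul ?polyXsubC_eq0 // !size_XsubC /=.
  by rewrite addn3 => -[].
have [a a0 [w qE]] : exists2 a, a != 0 & exists w, q = a *: ('X - w%:P).
  exists q`_1; first by have := lead_coef_eq0 q; rewrite /lead_coef size_q /= => ->.
  have q1 : q`_1 != 0 by have := lead_coef_eq0 q; rewrite /lead_coef size_q /= => ->.
  exists (- q`_0 / q`_1); apply/polyP => -[|[|k]]; rewrite coefZ coefB coefX coefC /=.
  - by field.
  - by rewrite subr0 mulr1.
  by rewrite subr0 mulr0 nth_default // size_q.
have PE3 : P = a%:P * 'X^3 - (a * (u + v + w))%:P * 'X^2
    + (a * (u * v + u * w + v * w))%:P * 'X - (a * (u * v * w))%:P.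
  by rewrite PE qE -mul_polyC !(polyCM, polyCD); ring.
have P_0 : P`_0 = - (a * (u * v * w)) by rewrite PE3 !coefE /=; ring.
have P_1 : P`_1 = a * (u * v + u * w + v * w) by rewrite PE3 !coefE /=; ring.
have P_2 : P`_2 = - (a * (u + v + w)) by rewrite PE3 !coefE /=; ring.
have P_3 : P`_3 = a by rewrite PE3 !coefE /=; ring.
have := coefP 0 isT; have := coefP 1 isT; have := coefP 2 isT.
rewrite P_0 P_1 P_2 !oppr_eq0 !mulf_eq0 (negPf a0) /= -!mulf_eq0 => e1 e2 e3.
have := hq 2 isT; have := hq 3 isT.
rewrite /second_quotient /= P_0 P_1 P_2 P_3 => h3 h2.
apply: (@three_roots_moduli u v w) => //.
  suff <- : (a * (u * v + u * w + v * w)) ^+ 2 / (- (a * (u * v * w)) * - (a * (u + v + w))) =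
    (u * v + u * w + v * w) ^+ 2 / (u * v * w * (u + v + w)) by [].
  move: e3; rewrite !mulf_eq0 !negb_or => /andP[/andP[u0 v0] w0].
  by field; apply/and5P.
suff <- : (- (a * (u + v + w))) ^+ 2 / (a * (u * v + u * w + v * w) * a) =
  (u + v + w) ^+ 2 / (u * v + u * w + v * w) by [].
by field; apply/andP.
Qed.

Lemma cubic_roots_simple_distinct_moduli P : full_poly_of_degree 3 P ->
  (forall k : nat, (2 <= k <= 3)%N -> (threshold R)%:C < `|second_quotient k P|) ->
  (forall z, root P z -> simple_zero P z) /\
  (forall z w, root P z -> root P w -> z != w -> `|z| != `|w|).
Proof.
move=> fullP hq; have [sizeP _] := fullP.
have P0 : P != 0 by rewrite -size_poly_eq0 sizeP.
split=> [z|z w rz rw zw].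
  rewrite root_factor_theorem XsubC_dvd // /simple_zero => z_gt0.
  apply/eqP; rewrite eqn_leq z_gt0 andbT leqNgt mup_geq //.
  (* A double zero would yield [|z| != |z|]. *)
  by apply/negP => /(cubic_factor_moduli fullP hq); rewrite eqxx.
apply: (cubic_factor_moduli fullP hq).
have := @uniq_roots_dvdp _ P [:: z; w].
by rewrite uniq_rootsE /= rz rw inE zw !big_cons big_nil mulr1; apply.
Qed.

Lemma extremal_cubic : exists Q : {poly R[i]},
  [/\ full_poly_of_degree 3 Q,
      forall k : nat, (2 <= k <= 3)%N -> `|second_quotient k Q| = (threshold R)%:C
    & exists z : R[i], multiple_zero Q z].
Proof.
pose r := extremal_root R.
have r_gt2 : 2 < r := extremal_root_gt2 R.
have q2E := extremal_q2 R; have q3E := extremal_q3 R.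
rewrite -/r in q2E q3E.
pose Q := ('X - 1%:P) ^+ 2 * ('X - (- r%:C)%:P) : {poly R[i]}.
have monQ : Q \is monic by rewrite monicMl ?monicXsubC // monic_exp ?monicXsubC.
have QE : Q = 'X^3 + (r - 2)%:C%:P * 'X^2 - (2 * r - 1)%:C%:P * 'X + r%:C%:P.
  by rewrite /Q !(rmorphB, rmorphM, rmorphN, rmorph1, rmorph_nat) /=; ring.
have Q_0 : Q`_0 = r%:C by rewrite QE !coefE /=; ring.
have Q_1 : Q`_1 = - (2 * r - 1)%:C by rewrite QE !coefE /=; ring.
have Q_2 : Q`_2 = (r - 2)%:C by rewrite QE !coefE /=; ring.
have Q_3 : Q`_3 = 1 by rewrite QE !coefE /=; ring.
have Q0 : Q != 0 by rewrite monic_neq0.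
exists Q; split.
- split.
    by rewrite /Q size_Mmonic ?monicXsubC ?size_exp_XsubC ?size_XsubC // expf_neq0 ?polyXsubC_eq0.
  have C0 (x : R) : 0 < x -> x%:C != 0 by rewrite -ltcR => /lt0r_neq0.
  case=> [|[|[|[|//]]]] _; rewrite ?Q_0 ?Q_1 ?Q_2 ?Q_3 ?oppr_eq0 ?oner_neq0 ?C0 //; lra.
- have normC_ge0 (x : R) : 0 <= x -> `|x%:C| = x%:C by rewrite -lecR => /ger0_norm.
  case=> [|[|[|[|//]]]] // _; rewrite /second_quotient /= ?Q_0 ?Q_1 ?Q_2 ?Q_3.
    rewrite sqrrN -!(rmorphXn, rmorphM) -fmorphV -rmorphM /= q2E mulfK; last first.
      by rewrite mulf_neq0 ?gt_eqF //; lra.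
    by rewrite normC_ge0 ?sqrtr_ge0.
  (* Here the quotient itself is -T. *)
  rewrite mulr1 invrN mulrN normrN -rmorphXn -fmorphV -rmorphM /= q3E mulfK; last first.
    by rewrite gt_eqF //; lra.
  by rewrite normC_ge0 ?sqrtr_ge0.
exists 1; rewrite /multiple_zero mup_geq //; exact: dvdp_mulr.
Qed.

End ComplexRoots.

(** * The numbers b_2 and b_4 *)

Lemma b_equation1 (R : realType) (y : R) : 0 < y -> b_equation 1 y <-> y = 4.
Proof.
move=> y0.
rewrite /b_equation big_nat1 expr1n div1r powRN powR12_sqrt ?ltW //.
have s0 : 0 < Num.sqrt y by rewrite sqrtr_gt0.
have sn : Num.sqrt y != 0 by rewrite gt_eqF.
have sq : Num.sqrt y ^+ 2 = y by rewrite sqr_sqrtr ?ltW.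
split=> h.
  have : Num.sqrt y = 2.
    apply/eqP; rewrite -subr_eq0.
    by rewrite -(mulIr_eq0 _ (mulIf (invr_neq0 sn))) mulrBl divff // h.
  by move=> e; rewrite -sq e; ring.
have -> : Num.sqrt y = 2; last by field.
by rewrite h (_ : 4 = 2 ^+ 2 :> R) ?sqrtr_sqr ?ger0_norm //; ring.
Qed.

(** The exponents are -1/2 and -2, so the equation is t + t^4 = 1/2 in t = y^(-1/2). *)
Lemma b_equation2 (R : realType) (y : R) : 0 < y ->
  b_equation 2 y <-> (Num.sqrt y)^-1 + (Num.sqrt y)^-1 ^+ 4 = 2^-1.
Proof.
move=> y0.
rewrite /b_equation big_nat_recr //= big_nat1 expr1n div1r !powRN powR12_sqrt ?ltW //.
have -> : 2 ^+ 2 / 2 = 2%:R :> R by field.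
rewrite powR_mulrn ?ltW // -[y in y ^+ 2](sqr_sqrtr (ltW y0)) -exprM -exprVn.
by split=> h; lra.
Qed.

Lemma threshold_between_b (R : realType) : exists b2 b4 : R,
  [/\ is_b 1 b2, is_b 2 b4, b2 = 4, b2 < threshold R & threshold R < b4].
Proof.
have /andP[T4 T45] := threshold_bounds R.
(* This root is the value of y^(-1/2) at y = b_4, hence b_4 = x^(-2). *)
have [x /andP[x0 x1]] : exists2 x : R, 0 <= x <= 1 & root ('X^4 + 'X - (2^-1)%:P) x.
  by apply: poly_ivt; rewrite ?ler01 // !hornerE /=; lra.
rewrite rootE !hornerE /= => /eqP xE.
have {}x0 : 0 < x by rewrite lt_neqAle x0 andbT; apply/eqP => xx; move: xE; rewrite -xx; lra.
have inv_x (y : R) : 0 < y -> b_equation 2 y <-> (Num.sqrt y)^-1 = x.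
  move=> y0; have t0 : 0 < (Num.sqrt y)^-1 by rewrite invr_gt0 sqrtr_gt0.
  rewrite b_equation2 //; move: (_^-1) t0 => t t0; split=> [tE|->]; last lra.
  apply/eqP; rewrite -subr_eq0.
  (* The second factor of the difference t^4 + t - x^4 - x is positive. *)
  have : (t - x) * (1 + (t + x) * (t ^+ 2 + x ^+ 2)) = 0 by lra.
  by move/eqP; rewrite mulf_eq0 => /orP[//|/eqP]; nra.
have b4_gt0 : 0 < (x ^+ 2)^-1 by rewrite invr_gt0 exprn_gt0.
have sqrt_b4 : Num.sqrt (x ^+ 2)^-1 = x^-1 by rewrite -exprVn sqrtr_sqr ger0_norm // invr_ge0 ltW.
exists 4, (x ^+ 2)^-1; split => //.
- split; first by split; [lra | apply/b_equation1; lra].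
  by move=> y [y0 /b_equation1 ->].
- split; first by split => //; apply/inv_x => //; rewrite sqrt_b4 invrK.
  move=> y [y0 /(inv_x _ y0) yx].
  by rewrite -yx exprVn invrK sqr_sqrtr // ltW.
(* The number 9/2 separates: b_4 < 9/2 would mean x^2 > 2/9, so x > 47/100 and x^4 + x > 1/2. *)
apply: lt_le_trans T45 _.
have -> : 45 / 10 = (2 / 9)^-1 :> R by field.
rewrite lef_pV2 ?posrE ?exprn_gt0 //; last lra.
have [//|x2] := leP (x ^+ 2) (2 / 9).
have : 4 / 81 < x ^+ 4 by nra.
have : 47 / 100 < x by nra.
lra.
Qed.

Theorem theorem1p4 (R : realType) :
  [/\ forall P : {poly R[i]},
        full_poly_of_degree 3 P ->
        (forall k : nat, (2 <= k <= 3)%N ->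
           (threshold R)%:C < `|second_quotient k P|) ->
        (forall z : R[i], root P z -> simple_zero P z) /\
        (forall z w : R[i], root P z -> root P w -> z != w -> `|z| != `|w|),
      exists b2 b4 : R,
        [/\ is_b 1 b2, is_b 2 b4, b2 = 4, b2 < threshold R & threshold R < b4]
    & exists Q : {poly R[i]},
        [/\ full_poly_of_degree 3 Q,
            forall k : nat, (2 <= k <= 3)%N ->
              `|second_quotient k Q| = (threshold R)%:C
          & exists z : R[i], multiple_zero Q z]].
Proof.
split; [|exact: threshold_between_b|exact: extremal_cubic].
exact: cubic_roots_simple_distinct_moduli.
Qed.
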